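(* Let $A$ be a complex $n\times n$ matrix whose eigenvalues are all real and nonnegative, let $B=A-\frac{\operatorname{tr}A}{n}I$, and suppose $0<\operatorname{tr}A\le\left(n\operatorname{tr}(B^2)\right)^{1/2}$. Then $$\operatorname{Spd}(A)\ge\frac{\operatorname{tr}(A^2)}{\operatorname{tr}A},$$ and, if $n\ge3$, $$\operatorname{Spd}(A)\le\frac{1}{\operatorname{tr}A}\left(2\operatorname{tr}(B^2)\,(\operatorname{tr}A)^2-\frac{\left(n\operatorname{tr}(B^2)-(\operatorname{tr}A)^2\right)^2}{n(n-2)}\right)^{1/2}.$$
   Context: For a matrix $A$ with real eigenvalues, the spread is $\operatorname{Spd}(A)=\lambda_{\max}(A)-\lambda_{\min}(A)$, the greatest distance between two eigenvalues. $I$ is the $n\times n$ identity matrix. *)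

(* Defs.v *)
From mathcomp Require Import all_boot all_order all_algebra.
From mathcomp Require Import all_classical reals.
From mathcomp Require Import complex.

Set Implicit Arguments.
Unset Strict Implicit.
Unset Printing Implicit Defensive.

Import Order.TTheory GRing.Theory Num.Theory.

Local Open Scope ring_scope.
Local Open Scope classical_set_scope.
Local Open Scope complex_scope.

(* On R[i] the order is the partial one: x <= y means that y - x is real and
   nonnegative; in particular [0 <= a] says that a is real and nonnegative. *)

Definition real_eigenvalues (R : realType) (n : nat) (A : 'M[R[i]]_n) : set R :=
  [set x : R | eigenvalue A x%:C].

(* The set of eigenvalues is finite, so for n > 0 and real eigenvalues the
   supremum and infimum are attained, see [lambda_maxP] and [lambda_minP]. *)
Definition lambda_max (R : realType) (n : nat) (A : 'M[R[i]]_n) : R :=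
  sup (real_eigenvalues A).

Definition lambda_min (R : realType) (n : nat) (A : 'M[R[i]]_n) : R :=
  inf (real_eigenvalues A).

Definition Spd (R : realType) (n : nat) (A : 'M[R[i]]_n) : R :=
  lambda_max A - lambda_min A.

Lemma eigenvalue_exists (R : realType) (n : nat) (A : 'M[R[i]]_n) :
  (0 < n)%N -> exists a, eigenvalue A a.
Proof.
move=> n0.
have /closed_rootP [a ra] : size (char_poly A) != 1%N.
  by rewrite size_char_poly -lt0n in n0 *; case: n n0 A.
by exists a; rewrite eigenvalue_root_char.
Qed.

Lemma real_eigenvalues_seq (R : realType) (n : nat) (A : 'M[R[i]]_n) :
  exists s : seq R, forall x, real_eigenvalues A x <-> x \in s.
Proof.
have [r Er] := closed_field_poly_normal (char_poly A).
exists [seq x <- [seq complex.Re z | z <- r] | eigenvalue A x%:C] => x.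
rewrite mem_filter; split=> [Ax|/andP[]//].
apply/andP; split=> //; apply/mapP; exists x%:C => //.
move: Ax; rewrite /real_eigenvalues /= eigenvalue_root_char Er.
by rewrite rootZ ?root_prod_XsubC // (monicP (char_poly_monic A)) oner_eq0.
Qed.

Lemma seq_max (R : realType) (s : seq R) x0 :
  x0 \in s -> exists2 m, m \in s & forall x, x \in s -> x <= m.
Proof.
elim: s x0 => // a s IH x0 _.
case: s IH => [_|b s IH].
  by exists a; rewrite ?mem_head // => x; rewrite inE => /eqP ->.
have [m ms Hm] := IH b (mem_head _ _).
case: (leP a m) => am.
  exists m; first by rewrite inE ms orbT.
  by move=> x; rewrite inE => /orP[/eqP -> //|/Hm].
exists a; first exact: mem_head.
move=> x; rewrite inE => /orP[/eqP -> //|/Hm xm].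
exact: le_trans xm (ltW am).
Qed.

Lemma eigenvalue_Re (R : realType) (n : nat) (A : 'M[R[i]]_n) :
  (forall a : R[i], eigenvalue A a -> a \is Num.real) ->
  forall a, eigenvalue A a -> a = (complex.Re a)%:C.
Proof. by move=> A_real a /A_real /RRe_real ->. Qed.

Lemma real_eigenvalues_neq0 (R : realType) (n : nat) (A : 'M[R[i]]_n) :
  (0 < n)%N -> (forall a : R[i], eigenvalue A a -> a \is Num.real) ->
  exists x, real_eigenvalues A x.
Proof.
move=> n_gt0 A_real.
have [a Aa] := eigenvalue_exists A n_gt0.
by exists (complex.Re a); rewrite /real_eigenvalues /= -(eigenvalue_Re A_real).
Qed.

Lemma lambda_maxP (R : realType) (n : nat) (A : 'M[R[i]]_n) :
  (0 < n)%N -> (forall a : R[i], eigenvalue A a -> a \is Num.real) ->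
  eigenvalue A (lambda_max A)%:C /\
  forall a, eigenvalue A a -> a <= (lambda_max A)%:C.
Proof.
move=> n_gt0 A_real.
have [s Hs] := real_eigenvalues_seq A;
have [x0 Ax0] := real_eigenvalues_neq0 n_gt0 A_real.
have [m /Hs Am Hm] := seq_max ((Hs x0).1 Ax0).
have E : lambda_max A = m.
  apply/eqP; rewrite eq_le; apply/andP; split.
    by apply: ge_sup; [exists x0 | move=> x /Hs /Hm].
  by apply: ub_le_sup => //; exists m => x /Hs /Hm.
rewrite E; split=> // a Aa; rewrite (eigenvalue_Re A_real Aa) lecR; apply/Hm/Hs.
by rewrite /real_eigenvalues /= -(eigenvalue_Re A_real).
Qed.

Lemma lambda_minP (R : realType) (n : nat) (A : 'M[R[i]]_n) :
  (0 < n)%N -> (forall a : R[i], eigenvalue A a -> a \is Num.real) ->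
  eigenvalue A (lambda_min A)%:C /\
  forall a, eigenvalue A a -> (lambda_min A)%:C <= a.
Proof.
move=> n_gt0 A_real.
have [s Hs] := real_eigenvalues_seq A;
have [x0 Ax0] := real_eigenvalues_neq0 n_gt0 A_real.
have [m' /mapP[m /Hs Am ->] Hm'] := seq_max (map_f -%R ((Hs x0).1 Ax0)).
have Hm x : x \in s -> m <= x by move=> xs; rewrite -lerN2 Hm' // map_f.
have E : lambda_min A = m.
  apply/eqP; rewrite eq_le; apply/andP; split.
    by apply: ge_inf => //; exists m => x /Hs /Hm.
  by apply: lb_le_inf; [exists x0 | move=> x /Hs /Hm].
rewrite E; split=> // a Aa; rewrite (eigenvalue_Re A_real Aa) lecR; apply/Hm/Hs.
by rewrite /real_eigenvalues /= -(eigenvalue_Re A_real).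
Qed.

(* Main.v *)
Require Import Defs.
From mathcomp Require Import all_boot all_order all_algebra.
From mathcomp Require Import all_classical reals.
From mathcomp Require Import complex.
From mathcomp Require Import spectral ring lra.
Import Order.TTheory GRing.Theory Num.Theory.
Local Open Scope ring_scope.
Local Open Scope complex_scope.

(** List the eigenvalues of [A] with multiplicity as nonnegative reals
[x 0, ..., x (n - 1)], and put [t := \sum_k x k = \tr A],
[q := \sum_k x k ^+ 2 = \tr (A ^+ 2)], [b := q - t ^+ 2 / n = \tr (B ^+ 2)];
let [M] and [m] be the largest and the smallest of them. The hypothesis on the
traces squares to [t ^+ 2 <= n b], that is [2 t ^+ 2 <= n q].

Both bounds come from the nonnegativity of [\sum_k (M - x k) * (x k - m)],
that is [q + n M m <= (M + m) t] ([sum_sqr_le_itv]).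

For the lower bound ([spread_ge]), this inequality gives
[(M - m) t - q >= m (n M - 2 t)]. The right side is nonnegative, because
[q <= M t], so that [2 t ^+ 2 <= n q <= n M t].

For the upper bound ([spread_le]), let [s := M + m - 2 t / n] be the sum of the
two extreme deviations from the mean. The other [n - 2] deviations sum to [- s],
so their squares sum to at least [s ^+ 2 / (n - 2)] ([sum_sqr_ge]), and the two
extreme squares sum to [((M - m) ^+ 2 + s ^+ 2) / 2]; hence
[(M - m) ^+ 2 <= 2 b - n s ^+ 2 / (n - 2)]. Since [n M m >= 0], the first
inequality gives [n s t >= n q - 2 t ^+ 2 = n b - t ^+ 2 >= 0]. Squaring bounds
[s ^+ 2] from below, and the result is the square of the stated estimate.

The passage from [A] to the family [x] is a Schur triangularization: the
diagonal of the triangular form lists the eigenvalues, its sum is the trace of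
[A], and the sum of its squares is the trace of [A ^+ 2]
([eigenvalue_family]). *)

(** * Finite families of real numbers *)

(** Each product [(M - x i) * (x i - m)] is nonnegative; sum over [i]. *)
Lemma sum_sqr_le_itv (F : realFieldType) (n : nat) (x : 'I_n -> F) (m M : F) :
  (forall i, m <= x i <= M) ->
  \sum_i x i ^+ 2 + n%:R * (M * m) <= (M + m) * \sum_i x i.
Proof.
move=> x_mM.
have : 0 <= \sum_i (M - x i) * (x i - m).
  by apply: sumr_ge0 => i _; have /andP[mx xM] := x_mM i; rewrite mulr_ge0 ?subr_ge0.
rewrite (eq_bigr (fun i => (M + m) * x i - (x i ^+ 2 + M * m))); last first.
  by move=> i _; ring.
by rewrite sumrB -mulr_sumr big_split sumr_const card_ord -(mulr_natl (M * m)) subr_ge0.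
Qed.

(** Nonnegativity makes [0] a lower bound for the [x i] as well; with [m := 0]
[sum_sqr_le_itv] is [q <= M t], which turns the hypothesis into [2 t <= n M]. *)
Lemma spread_ge (F : realFieldType) (n : nat) (x : 'I_n -> F) (m M : F) :
  0 <= m -> (forall i, m <= x i <= M) ->
  0 < \sum_i x i -> 2 * (\sum_i x i) ^+ 2 <= n%:R * \sum_i x i ^+ 2 ->
  \sum_i x i ^+ 2 <= (M - m) * \sum_i x i.
Proof.
move=> m0 x_mM; have := sum_sqr_le_itv F n x m M x_mM.
have : \sum_i x i ^+ 2 + n%:R * (M * 0) <= (M + 0) * \sum_i x i.
  by apply: sum_sqr_le_itv => i; have /andP[mx ->] := x_mM i; rewrite (le_trans m0).
set t := \sum_i x i; set q := \sum_i x i ^+ 2 => qMt qMm t0 tq.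
have n0 : 0 <= n%:R :> F by [].
have nM : 2 * t <= n%:R * M by rewrite -(ler_pM2r t0); nra.
nra.
Qed.

(** The last summand on the left is the least possible sum of squares of the
[n - 2] remaining entries, attained when they are all equal to their mean. *)
Lemma sum_sqr_ge (F : realFieldType) (n : nat) (x : 'I_n -> F) (i j : 'I_n) :
  i != j -> (2 < n)%N ->
  x i ^+ 2 + x j ^+ 2 + (\sum_k x k - x i - x j) ^+ 2 / (n%:R - 2)
    <= \sum_k x k ^+ 2.
Proof.
move=> ij n2; have n20 : 0 < n%:R - 2 :> F by rewrite subr_gt0 ltr_nat.
pose P k := (k != i) && (k != j).
have split2 (f : 'I_n -> F) : \sum_k f k = f i + f j + \sum_(k | P k) f k.
  by rewrite (bigD1 i) //= (bigD1 j) 1?eq_sym //= addrA.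
have cardP : \sum_(k | P k) 1 = n%:R - 2 :> F.
  by have := split2 (fun=> 1); rewrite sumr_const card_ord => ->; ring.
rewrite !split2; set s := \sum_(k | P k) x k; set q := \sum_(k | P k) _.
pose c := s / (n%:R - 2).
have : 0 <= \sum_(k | P k) (x k - c) ^+ 2 by apply: sumr_ge0 => k _; apply: sqr_ge0.
rewrite (eq_bigr (fun k => x k ^+ 2 - (2 * c) * x k + c ^+ 2 * 1)); last first.
  by move=> k _; ring.
rewrite big_split sumrB -!mulr_sumr /= cardP -/s -/q.
have -> : q - 2 * c * s + c ^+ 2 * (n%:R - 2) = q - s ^+ 2 / (n%:R - 2).
  by rewrite /c; field; rewrite gt_eqF.
have -> : x i + x j + s - x i - x j = s by ring.
by lra.
Qed.

(** The case where the extreme values occupy the indices [i] and [j]. Everything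
is squared so that the bound makes sense in a field without square roots. *)
Lemma spread_le (F : realFieldType) (n : nat) (x : 'I_n -> F) (i j : 'I_n) :
  (forall k, x j <= x k <= x i) -> (2 < n)%N ->
  0 <= x j -> 0 < \sum_k x k ->
  let t := \sum_k x k in let b := \sum_k x k ^+ 2 - t ^+ 2 / n%:R in
  t ^+ 2 <= n%:R * b ->
  ((x i - x j) * t) ^+ 2 <=
    2 * b * t ^+ 2 - (n%:R * b - t ^+ 2) ^+ 2 / (n%:R * (n%:R - 2)).
Proof.
move=> x_mM n2 xj0 t0 t b tb.
have n20 : 0 < n%:R - 2 :> F by rewrite subr_gt0 ltr_nat.
have n0 : 0 < n%:R :> F by lra.
(* If the extreme indices agree, the family is constant and [b = 0 < t ^+ 2]. *)
have ij : i != j.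
  apply/eqP => ij; move: tb; suff -> : n%:R * b = 0 by apply/negP; rewrite -ltNge exprn_gt0.
  have xE k : x k = x j by apply/eqP; rewrite eq_le andbC -{2}ij; apply: x_mM.
  have sumE h : \sum_k (x k) ^+ h = n%:R * x j ^+ h.
    rewrite (eq_bigr (fun=> x j ^+ h)) => [|k _]; last by rewrite xE.
    by rewrite sumr_const card_ord -(mulr_natl (x j ^+ h)).
  have tE : t = n%:R * x j by exact: (sumE 1%N).
  by rewrite /b sumE tE; field; rewrite gt_eqF.
have := sum_sqr_le_itv _ _ _ _ _ x_mM; have := sum_sqr_ge _ _ x _ _ ij n2; rewrite -/t.
set q := \sum_k x k ^+ 2 in b tb *.
set M := x i; set m := x j in xj0 * => qMm qMt.
pose s := M + m - 2 * t / n%:R.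
have nM0 : 0 <= n%:R * (M * m).
  by rewrite mulr_ge0 ?ler0n // mulr_ge0 // (le_trans xj0) //; have /andP[] := x_mM i.
have dev : n%:R * b - t ^+ 2 <= n%:R * s * t.
  have -> : n%:R * b - t ^+ 2 = n%:R * q - 2 * t ^+ 2 by rewrite /b; field; rewrite gt_eqF.
  have -> : n%:R * s * t = n%:R * ((M + m) * t) - 2 * t ^+ 2 by rewrite /s; field; rewrite gt_eqF.
  by rewrite lerD2r ler_pM2l //; lra.
have {dev} dev2 : (n%:R * b - t ^+ 2) ^+ 2 <= (n%:R * s * t) ^+ 2.
  by rewrite ler_sqr ?nnegrE //; lra.
(* The gap between the two sides is twice the gap in [sum_sqr_ge]. *)
have d2 : (M - m) ^+ 2 <= 2 * b - n%:R / (n%:R - 2) * s ^+ 2.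
  rewrite -subr_ge0.
  have -> : 2 * b - n%:R / (n%:R - 2) * s ^+ 2 - (M - m) ^+ 2 =
     2 * (q - (M ^+ 2 + m ^+ 2 + (t - M - m) ^+ 2 / (n%:R - 2))).
    by rewrite /s /b; field; rewrite !gt_eqF.
  by rewrite mulr_ge0 // subr_ge0.
rewrite exprMn; apply: le_trans (ler_wpM2r (sqr_ge0 t) d2) _.
rewrite mulrBl lerD2l lerN2 ler_pdivrMr ?mulr_gt0 //.
apply: le_trans dev2 _; rewrite le_eqVlt; apply/orP; left; apply/eqP.
by field; rewrite gt_eqF.
Qed.

(** * Traces and eigenvalues *)

Lemma mulmx_trig (K : pzSemiRingType) (n : nat) (S T : 'M[K]_n) :
  is_trig_mx S -> is_trig_mx T ->
  is_trig_mx (S *m T) /\ forall i, (S *m T) i i = S i i * T i i.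
Proof.
move=> /is_trig_mxP S0 /is_trig_mxP T0; split=> [|i].
  apply/is_trig_mxP => i j ij; rewrite mxE big1 // => k _.
  have [ik|ki] := ltnP i k; first by rewrite S0 ?mul0r.
  by rewrite T0 ?mulr0 // (leq_ltn_trans ki ij).
rewrite mxE (bigD1 i) //= big1 ?addr0 // => k; rewrite -val_eqE neq_ltn => /orP[ki|ik].
  by rewrite T0 ?mulr0.
by rewrite S0 ?mul0r.
Qed.

(** The witness is the diagonal of a Schur triangular form [T] of [A], hence the
eigenvalues with multiplicity; the diagonal of [T *m T] consists of the
squares of that of [T]. *)
Lemma eigenvalue_family (C : numClosedFieldType) (n : nat) (A : 'M[C]_n) :
  exists f : 'I_n -> C, [/\ forall a, eigenvalue A a <-> exists i, a = f i,
    \tr A = \sum_i f i & \tr (A ^+ 2) = \sum_i f i ^+ 2].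
Proof.
case: n A => [|n] A.
  exists (fun=> 0); split; rewrite /mxtrace ?big_ord0 // => a.
  split=> [|[[]] //]; by rewrite eigenvalue_root_char /char_poly det_mx00 (negbTE (root1 a)).
have [P /unitarymx_unit Pu] := Schur A (ltn0Sn n).
rewrite /similar_to conjumx //; set T := _ *m _ => trigT.
have trT X : \tr (P *m X *m invmx P) = \tr X by rewrite mxtrace_mulC mulKmx.
have [_ T2] := mulmx_trig _ _ _ _ trigT trigT.
exists (fun i => T i i); split.
- move=> a; have -> : eigenvalue A a = eigenvalue T a.
    by rewrite !eigenvalue_root_min /T -conjumx // mxminpoly_uconj.
  rewrite eigenvalue_root_char char_poly_trig //.
  rewrite -(big_map _ predT (fun x => 'X - x%:P)) root_prod_XsubC.
  split=> [/mapP[i _ ->]|[i ->]]; first by exists i.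
  by apply/mapP; exists i; rewrite // mem_index_enum.
- by rewrite -trT.
- rewrite -trT; apply: eq_bigr => i _; rewrite [RHS]expr2 -T2 /T.
  by rewrite [A ^+ 2]expr2 !mulmxA mulmxKV.
Qed.

Lemma tr_centered_sqr (K : fieldType) (n : nat) (A : 'M[K]_n) :
  n%:R != 0 :> K ->
  \tr ((A - (\tr A / n%:R)%:M) ^+ 2) = \tr (A ^+ 2) - (\tr A) ^+ 2 / n%:R.
Proof.
move=> n0; set c := \tr A / n%:R.
rewrite [in LHS]expr2 -[_ * _]/(_ *m _) mulmxBl !mulmxBr mul_mx_scalar !mul_scalar_mx.
rewrite !raddfB /= !mxtraceZ mxtrace_scalar -mulr_natr -[A *m A]/(A ^+ 2).
by rewrite /c; field.
Qed.

(** * The bounds on the spread *)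

Theorem theorem3p2 (R : realType) (n : nat) (A : 'M[R[i]]_n)
    (hA : forall a : R[i], eigenvalue A a -> a \is Num.real /\ 0 <= a) :
  let B : 'M[R[i]]_n := A - (\tr A / n%:R)%:M in
  0 < \tr A ->
  \tr A <= sqrtC (n%:R * \tr (B ^+ 2)) ->
  (Spd A)%:C >= \tr (A ^+ 2) / \tr A
  /\ ((3 <= n)%N ->
      (Spd A)%:C <= (\tr A)^-1 *
        sqrtC (2 * \tr (B ^+ 2) * (\tr A) ^+ 2
               - (n%:R * \tr (B ^+ 2) - (\tr A) ^+ 2) ^+ 2
                 / (n%:R * (n%:R - 2)))).
Proof.
move=> B t0 tB.
have n0 : (0 < n)%N.
  by case: n A hA @B t0 {tB} => // A; rewrite /mxtrace big_ord0 ltxx.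
have hreal a : eigenvalue A a -> a \is Num.real by case/hA.
have [f [eigf trf tr2f]] := eigenvalue_family _ _ A.
have [x fE] : exists x : 'I_n -> R, f = fun i => (x i)%:C.
  exists (fun i => complex.Re (f i)); apply: funext => i.
  by rewrite -(eigenvalue_Re hreal) //; apply/eigf; exists i.
move: eigf trf tr2f; rewrite {}fE => eigx trA tr2A {f}.
have eigx' i : eigenvalue A (x i)%:C by apply/eigx; exists i.
have [/eigx[i /complexI Mx] leM] := lambda_maxP n0 hreal.
have [/eigx[j /complexI mx] lem] := lambda_minP n0 hreal.
have x_mM k : x j <= x k <= x i.
  by rewrite -Mx -mx -!lecR lem ?leM.
have xj0 : 0 <= x j by rewrite -ler0c; have [] := hA _ (eigx' j).
pose t := \sum_k x k; pose q := \sum_k x k ^+ 2; pose b := q - t ^+ 2 / n%:R.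
have tE : \tr A = t%:C by rewrite trA rmorph_sum.
have qE : \tr (A ^+ 2) = q%:C.
  by rewrite tr2A rmorph_sum; apply: eq_bigr => k _; rewrite rmorphXn.
have bE : \tr (B ^+ 2) = b%:C.
  rewrite tr_centered_sqr ?pnatr_eq0 -?lt0n // tE qE.
  by rewrite /b rmorphB /= fmorph_div rmorphXn /= rmorph_nat.
move: t0 tB; rewrite bE qE tE /Spd Mx mx {bE qE tE} ltcR => t0 tB.
have tc0 : 0 <= t%:C by rewrite ler0c ltW.
(* Squaring is legitimate on both sides: [0 < t <= sqrtC _]. *)
have {tB} tb : t ^+ 2 <= n%:R * b.
  have nbE : n%:R * b%:C = (n%:R * b)%:C by rewrite rmorphM rmorph_nat.
  rewrite -lecR rmorphXn /= -nbE -[leRHS]sqrtCK.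
  by rewrite ler_sqr ?nnegrE // (le_trans tc0).
split=> [|n3].
  rewrite -fmorph_div lecR ler_pdivrMr //.
  apply: spread_ge => //; move: tb; rewrite -/t -/q /b.
  have n0' : n%:R != 0 :> R by rewrite pnatr_eq0 -lt0n.
  by have -> : n%:R * (q - t ^+ 2 / n%:R) = n%:R * q - t ^+ 2; [field | lra].
have tp : 0 < t%:C by rewrite ltcR.
rewrite ler_pdivlMl // -rmorphM /= mulrC.
have := spread_le _ _ _ _ _ x_mM n3 xj0 t0 tb; rewrite -/t -/q -/b => d2.
have dt0 : 0 <= ((x i - x j) * t)%:C.
  by rewrite ler0c mulr_ge0 ?(ltW t0) // subr_ge0; have /andP[] := x_mM i.
(* Compare both sides as square roots of real numbers. *)
rewrite -(sqrCK dt0) -rmorphXn /=.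
set w := 2 * b * _ - _ in d2.
have -> : 2 * b%:C * t%:C ^+ 2 - (n%:R * b%:C - t%:C ^+ 2) ^+ 2 /
    (n%:R * (n%:R - 2)) = w%:C.
  by rewrite /w !(rmorphB, rmorphM, fmorphV, rmorphXn, rmorph_nat).
have w0 : 0 <= w by apply: le_trans d2; apply: sqr_ge0.
by rewrite ler_sqrtC ?nnegrE ?ler0c ?lecR // sqr_ge0.
Qed.
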